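(* Let $h:\mathbb{C}\to\mathbb{C}$ be affine and $c\in\mathbb{C}$. Then the mapping $f(z)=h(z)^2+c$ is not uniformly quasiregular.
   Context: Affine mappings are taken in the normal form $h=h_{K,\theta}$, the stretch by a factor $K>0$ in the direction $e^{i\theta}$: $h_{K,\theta}(z)=\frac{K+1}{2}z+e^{2i\theta}\frac{K-1}{2}\bar z$. For a quasiregular map $F$ of the plane with complex dilatation $\mu_F=F_{\bar z}/F_z$, the maximal dilatation is $K(F)=\frac{1+\|\mu_F\|_\infty}{1-\|\mu_F\|_\infty}$. A quasiregular map $f:\mathbb{C}\to\mathbb{C}$ is uniformly quasiregular if there is a common bound on the maximal dilatations of all its iterates, i.e. $\sup_{n\ge1}K(f^n)<\infty$, where $f^n$ is the $n$-th iterate.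
   Formalization: The stretch factor is assumed to satisfy K ≠ 1, since for K = 1 the map h is the identity and f(z) = z² + c is holomorphic, so all its iterates have maximal dilatation 1 and f is uniformly quasiregular. *)

(* Defs.v *)
From HB Require Import structures.
From mathcomp Require Import all_boot all_order all_algebra.
From mathcomp Require Import complex.
From mathcomp Require Import all_classical all_reals all_analysis ess_sup_inf.

Set Implicit Arguments.
Unset Strict Implicit.
Unset Printing Implicit Defensive.

Import Order.TTheory GRing.Theory Num.Theory.
Import numFieldNormedType.Exports.

Local Open Scope classical_set_scope.
Local Open Scope complex_scope.
Local Open Scope ring_scope.

(* The complex plane is [R[i]] for a [realType] [R]; a.e. statements on it are
   taken through the coordinates [p |-> p.1 +i* p.2] on [R * R]. *)

Definition plane_measure (R : realType) :=
  (@lebesgue_measure R \x @lebesgue_measure R)%E.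
Arguments plane_measure : clear implicits.

(* [l i, r i] are pairwise non-overlapping subintervals of [a, b]. *)
Definition absolutely_continuous (R : realType) (a b : R) (g : R -> R) : Prop :=
  forall e : R, 0 < e -> exists2 d : R, 0 < d &
    forall (n : nat) (l r : 'I_n -> R),
      (forall i, a <= l i /\ l i <= r i /\ r i <= b) ->
      (forall i j, i != j -> r i <= l j \/ r j <= l i) ->
      \sum_(i < n) (r i - l i) < d ->
      \sum_(i < n) `|g (r i) - g (l i)| < e.

Section PlaneMaps.
Variable R : realType.
Implicit Types (F : R[i] -> R[i]) (z : R[i]).

Definition ACL F : Prop :=
  forall a b : R,
    {ae @lebesgue_measure R, forall y : R,
      absolutely_continuous a b (fun x => complex.Re (F (x +i* y))) /\
      absolutely_continuous a b (fun x => complex.Im (F (x +i* y)))} /\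
    {ae @lebesgue_measure R, forall x : R,
      absolutely_continuous a b (fun y => complex.Re (F (x +i* y))) /\
      absolutely_continuous a b (fun y => complex.Im (F (x +i* y)))}.

(* Real partial derivatives, componentwise: the library's derivative on the
   normed space [R[i]] would be the complex one. *)
Definition partial_x F z : R[i] :=
  derive1 (fun t : R => complex.Re (F (t +i* complex.Im z))) (complex.Re z) +i*
  derive1 (fun t : R => complex.Im (F (t +i* complex.Im z))) (complex.Re z).

Definition partial_y F z : R[i] :=
  derive1 (fun t : R => complex.Re (F (complex.Re z +i* t))) (complex.Im z) +i*
  derive1 (fun t : R => complex.Im (F (complex.Re z +i* t))) (complex.Im z).

Definition wirtinger F z : R[i] :=
  (partial_x F z - (0 +i* 1) * partial_y F z) / 2.

Definition wirtinger_bar F z : R[i] :=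
  (partial_x F z + (0 +i* 1) * partial_y F z) / 2.

Definition locally_L2 (g : R[i] -> R[i]) : Prop :=
  forall A : set (R * R), compact A ->
    (plane_measure R).-integrable A
      (fun p => ((Normc.normc (g (p.1 +i* p.2))) ^+ 2)%:E).

(* Analytic definition. For continuous [F], "ACL with partial derivatives in
   L^2_loc" is membership in the Sobolev space W^{1,2}_loc, the classical
   partial derivatives being then the weak ones. *)
Definition quasiregular F : Prop :=
  [/\ continuous (F : (R[i] : numFieldType) -> (R[i] : numFieldType)),
      ACL F,
      locally_L2 (partial_x F),
      locally_L2 (partial_y F) &
      exists2 k : R, 0 <= k < 1 &
        {ae plane_measure R, forall p : R * R,
          Normc.normc (wirtinger_bar F (p.1 +i* p.2)) <=
          k * Normc.normc (wirtinger F (p.1 +i* p.2))}].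

(* Value 0 where [wirtinger F z = 0]; for quasiregular [F], [wirtinger_bar F]
   vanishes a.e. there as well. *)
Definition complex_dilatation F z : R[i] := wirtinger_bar F z / wirtinger F z.

Definition dilatation_norm F : \bar R :=
  ess_sup (plane_measure R)
    (fun p => (Normc.normc (complex_dilatation F (p.1 +i* p.2)))%:E).

(* (1 + m) / (1 - m), read as +oo when m is not < 1. *)
Definition maximal_dilatation F : \bar R :=
  let m := dilatation_norm F in
  if (m < 1)%E then ((1 + fine m) / (1 - fine m))%:E else +oo%E.

Definition uniformly_quasiregular F : Prop :=
  quasiregular F /\
  (ereal_sup [set maximal_dilatation (iter n F) | n in [set n | (1 <= n)%N]]
     < +oo)%E.

Definition affine_stretch (K theta : R) (z : R[i]) : R[i] :=
  ((K + 1) / 2)%:C * z +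
  (cos (2 * theta) +i* sin (2 * theta)) * ((K - 1) / 2)%:C * conjc z.

End PlaneMaps.

(* Main.v *)
Require Import Defs.
From HB Require Import structures.
From mathcomp Require Import all_boot all_order all_algebra.
From mathcomp Require Import complex.
From mathcomp Require Import all_classical all_reals all_analysis.
From mathcomp Require Import ess_sup_inf ring lra.

(* Let H = h^2. Rescaling a fixed iterate f^n near infinity makes the constant
   [c] disappear, so a bound on the dilatation of f^n is inherited by H^n. Since
   Im(h(w)^2 conj w) is odd on the plane, H has a fixed ray, hence a fixed point
   z <> 0, and by homogeneity DH(z) has the real eigenvalue 2. Let d be the other
   eigenvalue and B <> 0 the antilinear coefficient of DH(z). That of DH(z)^n is
   p_n B with p_n = (2^n - d^n) / (2 - d) (or n 2^(n-1) if d = 2), and a uniform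
   bound on the dilatations would give p_n^2 <= C (2d)^n, which fails along
   n = 2^j because p_2n^2 = (2^n + d^n)^2 p_n^2 >= 4 (2d)^n p_n^2. *)

Set Implicit Arguments.
Unset Strict Implicit.
Unset Printing Implicit Defensive.

Import Order.TTheory GRing.Theory Num.Theory.
Import numFieldNormedType.Exports.

Local Open Scope classical_set_scope.
Local Open Scope complex_scope.
Local Open Scope ring_scope.

(** * Iterated derivatives of h(z)^2 + c and their closed form at a fixed point of h^2 *)

Section QuadraticOrbits.
Variables (R : realType) (al : R) (be : R[i]).
Implicit Types (z w a b : R[i]) (gam : nat -> R[i]) (n : nat).

Definition sqn z : R := complex.Re z ^+ 2 + complex.Im z ^+ 2.

Definition hmap z : R[i] := al%:C * z + be * conjc z.

(* The constant added at step [m] is [gam m]; the rescaled orbits need constants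
   that vary with the step. *)
Fixpoint fwd_orbit gam z n : R[i] :=
  if n is m.+1 then hmap (fwd_orbit gam z m) ^+ 2 + gam m else z.

(* The Wirtinger derivatives [(d/dz, d/dconj z)] of [z |-> fwd_orbit gam z n],
   propagated by the chain rule. *)
Fixpoint jac gam z n : R[i] * R[i] :=
  if n is m.+1 then
    let H := 2 * hmap (fwd_orbit gam z m) in
    let ab := jac gam z m in
    (H * (al%:C * ab.1 + be * conjc ab.2), H * (al%:C * ab.2 + be * conjc ab.1))
  else (1, 0).

Lemma sqn_ge0 z : 0 <= sqn z.
Proof. by rewrite /sqn addr_ge0 ?sqr_ge0. Qed.

Lemma sqn_eq0 z : (sqn z == 0) = (z == 0).
Proof.
by rewrite /sqn paddr_eq0 ?sqr_ge0 // !sqrf_eq0 eq_complex.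
Qed.

Lemma sqnM z w : sqn (z * w) = sqn z * sqn w.
Proof. by case: z w => [x y] [u v]; rewrite /sqn /=; ring. Qed.

Lemma sqnN z : sqn (- z) = sqn z.
Proof. by case: z => x y; rewrite /sqn /= !sqrrN. Qed.

Lemma sqnJ z : sqn (conjc z) = sqn z.
Proof. by case: z => x y; rewrite /sqn /= sqrrN. Qed.

Lemma normc_sqn z : Normc.normc z = Num.sqrt (sqn z).
Proof. by case: z. Qed.

(** The real-linear map w -> a w + b conj w has determinant |a|^2 - |b|^2, so this is
    multiplicativity of determinants: [4 * sqn H] comes from multiplication by [2 * H],
    [al ^+ 2 - sqn be] from [hmap]. *)
Lemma jac_det_step (H a b : R[i]) :
  sqn (2 * H * (al%:C * a + be * conjc b)) -
    sqn (2 * H * (al%:C * b + be * conjc a)) =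
  4 * sqn H * (al ^+ 2 - sqn be) * (sqn a - sqn b).
Proof.
rewrite !sqnM.
have -> : sqn 2 = 4 by rewrite /sqn /=; ring.
rewrite -mulrBr -[RHS]mulrA; congr (_ * _).
by case: be a b => [p q] [x y] [u v]; rewrite /sqn /=; ring.
Qed.

Lemma jac_det_ge0 gam z n : sqn be <= al ^+ 2 ->
  sqn (jac gam z n).2 <= sqn (jac gam z n).1.
Proof.
move=> hbe; elim: n => [|n IH] /=; first by rewrite /sqn /= !expr0n/= expr1n; lra.
rewrite -subr_ge0 jac_det_step !mulr_ge0 ?subr_ge0 ?sqn_ge0 //.
Qed.

Lemma conjcM z w : conjc (z * w) = conjc z * conjc w.
Proof. exact: rmorphM. Qed.

Lemma conjcD z w : conjc (z + w) = conjc z + conjc w.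
Proof. exact: rmorphD. Qed.

Lemma hmap_scale (e : R) z : hmap (e%:C * z) = e%:C * hmap z.
Proof. by rewrite /hmap conjcM conjc_real; ring. Qed.

(* The powers of [e] turn the constant [c] into constants that vanish as
   [e] tends to [0], without changing the dilatation. *)
Lemma orbit_scale (e : R) c z n :
  fwd_orbit (fun m => (e ^+ (2 ^ m.+1))%:C * c) (e%:C * z) n =
  (e ^+ (2 ^ n))%:C * fwd_orbit (fun=> c) z n.
Proof.
elim: n => [|n IH] /=; first by rewrite expn0 expr1.
by rewrite IH hmap_scale expnS mulnC exprM !rmorphXn /= exprMn mulrDr.
Qed.

(** Differentiating [orbit_scale] in z costs one factor [e], hence the exponent 2^n - 1. For e <> 0
    the common factor [u] cancels in the dilatation. *)
Lemma jac_scale (e : R) c z n :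
  let J := jac (fun=> c) z n in
  let u := (e ^+ (2 ^ n).-1)%:C in
  jac (fun m => (e ^+ (2 ^ m.+1))%:C * c) (e%:C * z) n = (u * J.1, u * J.2).
Proof.
elim: n => [|n IH]; first by rewrite /= expr0 !mul1r.
rewrite /= IH /= orbit_scale hmap_scale.
have -> : (2 ^ n.+1).-1 = (2 ^ n + (2 ^ n).-1)%N.
  by rewrite expnS mul2n -addnn; case: (2 ^ n)%N (expn_gt0 2 n) => // m _; rewrite addnS.
rewrite !conjcM !conjc_real exprD [in RHS]rmorphM /=.
by congr (_, _); ring.
Qed.


(* The real differential [w |-> A w + B conj w] at the fixed point [z] has the
   eigenvector [z] with eigenvalue [2], hence [|A - 2| = |B|]. *)
Lemma fixed_sqn z : z != 0 -> hmap z ^+ 2 = z ->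
  let A := 2 * hmap z * al%:C in
  sqn (2 * hmap z * be) = sqn A - 4 * complex.Re A + 4.
Proof.
move=> z0 hz A; set B := 2 * hmap z * be.
have h1 : (A - 2) * z = - (B * conjc z).
  by rewrite mulrBl -[in 2 * z]hz /A /B /hmap; ring.
have <- : sqn (A - 2) = sqn B.
  apply: (@mulIf _ (sqn z)); first by rewrite sqn_eq0.
  by rewrite -sqnM h1 sqnN !sqnM sqnJ.
by case: (A) => [x y]; rewrite /sqn /=; ring.
Qed.

(* Cayley-Hamilton for the differential at [z], with eigenvalues [2] and
   [2 * complex.Re A - 2]. *)
Lemma fixed_cayley_hamilton z : z != 0 -> hmap z ^+ 2 = z ->
  let A := 2 * hmap z * al%:C in
  let B := 2 * hmap z * be in
  A * A + B * conjc B = (2 * complex.Re A)%:C * A - (2 * (2 * complex.Re A - 2))%:C.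
Proof.
move=> z0 hz A B; have h3 := fixed_sqn z0 hz.
have -> : B * conjc B = (sqn B)%:C.
  case: (B) => [x y]; apply/eqP; rewrite eq_complex /sqn /=.
  by apply/andP; split; apply/eqP; ring.
rewrite h3 -/A; case: (A) => [x y]; apply/eqP; rewrite eq_complex /sqn /=.
by apply/andP; split; apply/eqP; ring.
Qed.

Lemma orbit_fixed z n : hmap z ^+ 2 = z -> fwd_orbit (fun=> 0) z n = z.
Proof. by move=> hz; elim: n => //= n ->; rewrite addr0. Qed.

(** The recursion avoids dividing by 2 - d, so d = 2 needs no separate case. *)
Fixpoint powcoef (d : R) n : R :=
  if n is m.+1 then d * powcoef d m + 2 ^+ m else 0.

(** For M the differential at [z], with eigenvalues 2 and d, Cayley-Hamilton gives M^n = p M + (2^n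
    - 2p) I, and I has no antilinear part. *)
Lemma jac_fixed z n : z != 0 -> hmap z ^+ 2 = z ->
  let A := 2 * hmap z * al%:C in
  let B := 2 * hmap z * be in
  let p := powcoef (2 * complex.Re A - 2) n in
  jac (fun=> 0) z n = (p%:C * A + (2 ^+ n - 2 * p)%:C, p%:C * B).
Proof.
move=> z0 hz A B; elim: n => [|n IH] p.
  by rewrite /p /= !mul0r mulr0 add0r expr0 subr0.
rewrite {}/p [jac _ _ _]/= IH orbit_fixed //; move: (fixed_cayley_hamilton z0 hz).
rewrite -/A -/B; set d := 2 * complex.Re A - 2; move=> hd.
set p := powcoef d n => /=; rewrite -/p.
congr (_, _).
  (* M^2 has linear coefficient [A * A + B * conjc B] and antilinear coefficient
     [B * (A + conjc A)]. *)
  transitivity (p%:C * (A * A + B * conjc B) + (2 ^+ n - 2 * p)%:C * A).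
    by rewrite conjcM conjc_real /A /B; ring.
  rewrite hd; have -> : 2 * complex.Re A = d + 2 by rewrite /d; ring.
  by rewrite exprS !(rmorphD, rmorphN, rmorphM, rmorph_nat, rmorphXn) /=; ring.
transitivity (p%:C * (B * (A + conjc A)) + (2 ^+ n - 2 * p)%:C * B).
  by rewrite conjcD conjcM !conjc_real /A /B; ring.
have -> : A + conjc A = (d + 2)%:C.
  by rewrite addcJ /d subrK rmorphM rmorph_nat.
by rewrite !(rmorphD, rmorphN, rmorphM, rmorph_nat, rmorphXn) /=; ring.
Qed.

(** For m = n this is the doubling rule p_2n = (2^n + d^n) p_n. *)
Lemma powcoefD (d : R) m n :
  powcoef d (n + m) = d ^+ m * powcoef d n + 2 ^+ n * powcoef d m.
Proof.
elim: m => [|m IH]; first by rewrite addn0 expr0 /= mul1r mulr0 addr0.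
by rewrite addnS /= IH exprS exprD; ring.
Qed.

Lemma powcoef_pow2 (d : R) j : 0 < d ->
  4 ^+ j * (2 * d) ^+ (2 ^ j) <= 2 * d * powcoef d (2 ^ j) ^+ 2.
Proof.
move=> d0; elim: j => [|j IH]; first by rewrite expn0 /= expr0 !expr1; nra.
rewrite expnS mul2n -addnn powcoefD exprD exprS.
set N := (2 ^ j)%N in IH *; set p := powcoef d N in IH *.
apply: (@le_trans _ _ (4 * (2 * d) ^+ N * (2 * d * p ^+ 2))).
  rewrite [leLHS](_ : _ = 4 * (2 * d) ^+ N * (4 ^+ j * (2 * d) ^+ N)); last by ring.
  by rewrite ler_wpM2l // mulr_ge0 // exprn_ge0 // mulr_ge0 // ltW.
rewrite exprMn; set x := 2 ^+ N; set y := d ^+ N.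
(* This yields (x + y)^2 >= 4xy = 4 (2d)^N, so each doubling gains a factor 4. *)
have := sqr_ge0 (x - y).
have : 0 <= 2 * d * p ^+ 2 by rewrite mulr_ge0 ?sqr_ge0 // mulr_ge0 // ltW.
by nra.
Qed.

Lemma powcoef_unbounded (d k : R) : 0 < d -> 0 < k ->
  ~ (forall n, k * powcoef d n ^+ 2 <= (2 * d) ^+ n).
Proof.
move=> d0 k0 H; have d2 : 0 < 2 * d by rewrite mulr_gt0.
(* At n = 2^j the power of 2d cancels, which would leave 4^j bounded. *)
have H4 j : k * 4 ^+ j <= 2 * d.
  have X : 0 < (2 * d) ^+ (2 ^ j) by rewrite exprn_gt0.
  rewrite -(ler_pM2r X) -mulrA.
  apply: (le_trans (ler_wpM2l (ltW k0) (powcoef_pow2 j d0))).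
  by rewrite mulrCA ler_wpM2l // ltW.
pose j := Num.bound (2 * d / k).
have hj : 2 * d / k < j%:R by rewrite archi_boundP // divr_ge0 // ltW.
have := H4 j; apply/negP; rewrite -ltNge -ltr_pdivrMl // mulrC.
apply: (lt_le_trans hj); rewrite -natrX ler_nat ltnW //.
exact: ltn_expl.
Qed.

End QuadraticOrbits.

(** * Continuity of orbits and derivatives through real and imaginary parts *)

Section ComponentwiseContinuity.
Variables (R : realType) (T : topologicalType).
Implicit Types (f g : T -> R[i]) (u v : T -> R).

Definition ccont f :=
  continuous (fun t => complex.Re (f t)) /\ continuous (fun t => complex.Im (f t)).

Lemma ccont_cst (c : R[i]) : ccont (fun=> c).
Proof. by split; apply: cst_continuous. Qed.

Lemma ccontD f g : ccont f -> ccont g -> ccont (fun t => f t + g t).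
Proof.
move=> [f1 f2] [g1 g2]; split => t.
- rewrite (_ : (fun _ => _) = (fun t => complex.Re (f t)) + (fun t => complex.Re (g t))).
    exact: continuousD (f1 t) (g1 t).
  by apply/funext => s; rewrite !fctE /=; case: (f s) (g s) => [? ?] [].
- rewrite (_ : (fun _ => _) = (fun t => complex.Im (f t)) + (fun t => complex.Im (g t))).
    exact: continuousD (f2 t) (g2 t).
  by apply/funext => s; rewrite !fctE /=; case: (f s) (g s) => [? ?] [].
Qed.

Lemma ccontM f g : ccont f -> ccont g -> ccont (fun t => f t * g t).
Proof.
move=> [f1 f2] [g1 g2]; split => t.
- rewrite (_ : (fun _ => _) = ((fun t => complex.Re (f t)) \* (fun t => complex.Re (g t)))
     - ((fun t => complex.Im (f t)) \* (fun t => complex.Im (g t)))).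
    exact: continuousB (continuousM (f1 t) (g1 t)) (continuousM (f2 t) (g2 t)).
  by apply/funext => s; rewrite !fctE /=; case: (f s) (g s) => [? ?] [].
- rewrite (_ : (fun _ => _) = ((fun t => complex.Re (f t)) \* (fun t => complex.Im (g t)))
     + ((fun t => complex.Im (f t)) \* (fun t => complex.Re (g t)))).
    exact: continuousD (continuousM (f1 t) (g2 t)) (continuousM (f2 t) (g1 t)).
  by apply/funext => s; rewrite !fctE /=; case: (f s) (g s) => [? ?] [].
Qed.

Lemma ccontJ f : ccont f -> ccont (fun t => conjc (f t)).
Proof.
move=> [f1 f2]; split => t.
- rewrite (_ : (fun _ => _) = (fun t => complex.Re (f t))); first exact: f1.
  by apply/funext => s; case: (f s).
- rewrite (_ : (fun _ => _) = - (fun t => complex.Im (f t))).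
    exact: continuousN (f2 t).
  by apply/funext => s; rewrite !fctE /=; case: (f s).
Qed.

Lemma sqn_continuous f : ccont f -> continuous (fun t => sqn (f t)).
Proof.
move=> /[dup] cf [f1 f2]; have [h _] := ccontM cf (ccontJ cf) => t.
rewrite (_ : (fun _ => _) = (fun t => complex.Re (f t * conjc (f t)))); first exact: h.
by apply/funext => s; rewrite /sqn; case: (f s) => x y /=; ring.
Qed.

Lemma sub_sqn_continuous (k : R) f g : ccont f -> ccont g ->
  continuous (fun t => sqn (f t) - k * sqn (g t)).
Proof.
move=> cf cg t.
rewrite (_ : (fun _ => _) = (fun t => sqn (f t)) - ((fun=> k) \* (fun t => sqn (g t)))) //.
apply: continuousB; first exact: sqn_continuous.
by apply: continuousM; [exact: cst_continuous|exact: sqn_continuous].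
Qed.

Lemma ccont_hmap al be f : ccont f -> ccont (fun t => hmap al be (f t)).
Proof.
by move=> cf; apply: ccontD; apply: ccontM; [exact: ccont_cst| |exact: ccont_cst|exact: ccontJ].
Qed.

(** Two uses are intended: a moving starting point with fixed constants, and a fixed starting point
    with constants depending on the scale. *)
Lemma ccont_orbit al be (gam : T -> nat -> R[i]) f n :
  (forall m, ccont (gam ^~ m)) -> ccont f ->
  ccont (fun t => fwd_orbit al be (gam t) (f t) n).
Proof.
move=> cg cf; elim: n => //= n IH; apply: ccontD => //.
by apply: ccontM; apply: ccont_hmap.
Qed.

Lemma ccont_jac al be (gam : T -> nat -> R[i]) f n :
  (forall m, ccont (gam ^~ m)) -> ccont f ->
  ccont (fun t => (jac al be (gam t) (f t) n).1) /\
  ccont (fun t => (jac al be (gam t) (f t) n).2).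
Proof.
move=> cg cf; elim: n => [|n [IH1 IH2]] /=; first by split; apply: ccont_cst.
have cO := ccont_hmap al be (ccont_orbit al be n cg cf).
have cH := ccontM (ccont_cst 2) cO.
by split; apply: (ccontM cH); apply: ccontD;
  apply: (ccontM (ccont_cst _)) => //; apply: ccontJ.
Qed.

End ComponentwiseContinuity.

(** * Derivatives along real lines and the Wirtinger derivatives of orbits *)

Section ComponentwiseDerivative.
Variable R : realType.
Implicit Types (f g : R -> R[i]) (x : R) (v w : R[i]).

Definition is_cderive f x v :=
  is_derive x 1 (fun t => complex.Re (f t)) (complex.Re v) /\
  is_derive x 1 (fun t => complex.Im (f t)) (complex.Im v).

Lemma is_cderive_cst (c : R[i]) x : is_cderive (fun=> c) x 0.
Proof. by split; apply: is_derive_cst. Qed.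

Lemma is_cderiveD f g x v w : is_cderive f x v -> is_cderive g x w ->
  is_cderive (fun t => f t + g t) x (v + w).
Proof.
move=> [f1 f2] [g1 g2]; split.
- rewrite (_ : (fun _ => _) = (fun t => complex.Re (f t)) + (fun t => complex.Re (g t))).
    by apply: is_derive_eq; case: v w {f1 f2 g1 g2} => [? ?] [].
  by apply/funext => s; rewrite !fctE /=; case: (f s) (g s) => [? ?] [].
- rewrite (_ : (fun _ => _) = (fun t => complex.Im (f t)) + (fun t => complex.Im (g t))).
    by apply: is_derive_eq; case: v w {f1 f2 g1 g2} => [? ?] [].
  by apply/funext => s; rewrite !fctE /=; case: (f s) (g s) => [? ?] [].
Qed.

Lemma is_cderiveM f g x v w : is_cderive f x v -> is_cderive g x w ->
  is_cderive (fun t => f t * g t) x (f x * w + g x * v).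
Proof.
move=> [f1 f2] [g1 g2]; split.
- rewrite (_ : (fun _ => _) = ((fun t => complex.Re (f t)) * (fun t => complex.Re (g t)))
     - ((fun t => complex.Im (f t)) * (fun t => complex.Im (g t)))).
    apply: is_derive_eq; case: v w (f x) (g x) {f1 f2 g1 g2} => [? ?] [? ?] [? ?] [? ?].
    by rewrite /GRing.scale /=; ring.
  by apply/funext => s; rewrite !fctE /=; case: (f s) (g s) => [? ?] [].
- rewrite (_ : (fun _ => _) = ((fun t => complex.Re (f t)) * (fun t => complex.Im (g t)))
     + ((fun t => complex.Im (f t)) * (fun t => complex.Re (g t)))).
    apply: is_derive_eq; case: v w (f x) (g x) {f1 f2 g1 g2} => [? ?] [? ?] [? ?] [? ?].
    by rewrite /GRing.scale /=; ring.
  by apply/funext => s; rewrite !fctE /=; case: (f s) (g s) => [? ?] [].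
Qed.

Lemma is_cderiveJ f x v : is_cderive f x v -> is_cderive (fun t => conjc (f t)) x (conjc v).
Proof.
move=> [f1 f2]; split.
- rewrite (_ : (fun _ => _) = (fun t => complex.Re (f t))); last first.
    by apply/funext => s; case: (f s).
  by case: v f1 {f2}.
- rewrite (_ : (fun _ => _) = - (fun t => complex.Im (f t))); last first.
    by apply/funext => s; rewrite !fctE /=; case: (f s).
  by apply: is_derive_eq; case: v {f1 f2}.
Qed.

Lemma is_cderive_hmap al be f x v : is_cderive f x v ->
  is_cderive (fun t => hmap al be (f t)) x (hmap al be v).
Proof.
move=> df.
have := is_cderiveD (is_cderiveM (is_cderive_cst al%:C x) df)
  (is_cderiveM (is_cderive_cst be x) (is_cderiveJ df)).
by rewrite !mulr0 !addr0.
Qed.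

(** The chain rule behind the recursion in [jac]: [hmap] is real-linear, so it is its own
    differential, and squaring contributes the factor [2 * hmap]. *)
Lemma is_cderive_orbit al be gam f x v n : is_cderive f x v ->
  let ab := jac al be gam (f x) n in
  is_cderive (fun t => fwd_orbit al be gam (f t) n) x (ab.1 * v + ab.2 * conjc v).
Proof.
move=> df; elim: n => [|n /= IH] /=; first by rewrite mul1r mul0r addr0.
set a := (jac _ _ _ _ _).1 in IH *; set b := (jac _ _ _ _ _).2 in IH *.
have dh := is_cderive_hmap al be IH.
have := is_cderiveD (is_cderiveM dh dh) (is_cderive_cst (gam n) x).
congr is_cderive; rewrite addr0 /hmap conjcD !conjcM conjcK.
by ring.
Qed.

Lemma is_cderive_Complex (f g : R -> R) x (u v : R) :
  is_derive x 1 f u -> is_derive x 1 g v ->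
  is_cderive (fun t => f t +i* g t) x (u +i* v).
Proof. by []. Qed.

Lemma is_cderive_derive1 f x v : is_cderive f x v ->
  derive1 (fun t => complex.Re (f t)) x +i* derive1 (fun t => complex.Im (f t)) x = v.
Proof. by move=> [f1 f2]; rewrite !derive1E !derive_val; case: v {f1 f2}. Qed.

(** The directions 1 and i give the partials a + b and i(a - b), which are solved for a and b. *)
Lemma wirtinger_orbit al be gam n z :
  wirtinger (fun w => fwd_orbit al be gam w n) z = (jac al be gam z n).1 /\
  wirtinger_bar (fun w => fwd_orbit al be gam w n) z = (jac al be gam z n).2.
Proof.
case: z => x y; set ab := jac _ _ _ _ _.
have hx : partial_x (fun w => fwd_orbit al be gam w n) (x +i* y) = ab.1 + ab.2.
  have dx : is_cderive (fun t : R => t +i* y) x (1 +i* 0).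
    by apply: is_cderive_Complex.
  rewrite /partial_x /= (is_cderive_derive1 (is_cderive_orbit al be gam n dx)) -/ab.
  by rewrite complexr0 conjc_real !mulr1.
have hy : partial_y (fun w => fwd_orbit al be gam w n) (x +i* y) = 'i * (ab.1 - ab.2).
  have dy : is_cderive (fun t : R => x +i* t) y (0 +i* 1).
    by apply: is_cderive_Complex.
  rewrite /partial_y /= (is_cderive_derive1 (is_cderive_orbit al be gam n dy)) -/ab.
  by case: ab.1 ab.2 => [? ?] [? ?]; apply/eqP; rewrite eq_complex /=; apply/andP; split; apply/eqP; ring.
have i2 : 'i * 'i = -1 :> R[i] by rewrite -expr2 sqr_i.
have c2 : (2 : R[i]) != 0 by rewrite pnatr_eq0.
by rewrite /wirtinger /wirtinger_bar hx hy mulrA i2; split; field.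
Qed.

End ComponentwiseDerivative.

(** * From almost everywhere dilatation bounds to the contradiction at a fixed point *)

Section Dilatation.
Variable R : realType.

(** Otherwise a null set would contain a square of side 2e, of measure (2e)^2 > 0. *)
Lemma ae_open_witness (U P : set (R * R)) (p : R * R) :
  open U -> U p -> {ae plane_measure R, forall q, P q} -> exists2 q, U q & P q.
Proof.
move=> oU Up [A [mA A0 PA]]; apply: contrapT => nPU.
have UA : U `<=` A.
  by move=> q Uq; apply: PA => Pq; apply: nPU; exists q.
have /nbhs_ballP[e /= e0 eU] : nbhs p U by apply: open_nbhs_nbhs.
have BA : ball p.1 e `*` ball p.2 e `<=` A.
  by move=> q [q1 q2]; apply: UA; apply: eU.
have mB (x : R) : measurable (ball x e : set (measurableTypeR R)) by rewrite ball_itv; exact: measurable_itv.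
have : (plane_measure R (ball p.1 e `*` ball p.2 e) <= 0)%E.
  rewrite -A0; apply: le_measure => //; rewrite inE //.
  exact: measurableX (mB _) (mB _).
have -> : plane_measure R (ball p.1 e `*` ball p.2 e) = ((e *+ 2) * (e *+ 2))%:E.
  rewrite EFinM -{1}(lebesgue_measure_ball p.1 (ltW e0)).
  rewrite -(lebesgue_measure_ball p.2 (ltW e0)).
  exact: product_measure1E.
by rewrite lee_fin leNgt mulr_gt0 // mulrn_wgt0.
Qed.

(** For m < 1, (1 + m)/(1 - m) <= C amounts to m <= (C - 1)/(C + 1). *)
Lemma maximal_dilatation_le (F : R[i] -> R[i]) (C : R) : 1 <= C ->
  (maximal_dilatation F <= C%:E)%E ->
  {ae plane_measure R, forall p : R * R,
    Normc.normc (complex_dilatation F (p.1 +i* p.2)) <= (C - 1) / (C + 1)}.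
Proof.
move=> C1; rewrite /maximal_dilatation; case: ifPn => // m1 mC.
have mk : (dilatation_norm F <= ((C - 1) / (C + 1))%:E)%E.
  case: (dilatation_norm F) m1 mC => [r| |] //=; last by rewrite leNye.
  rewrite lte_fin => r1.
  rewrite !lee_fin => h.
  have r1' : 0 < 1 - r by rewrite subr_gt0.
  rewrite ler_pdivrMr // in h.
  by rewrite ler_pdivlMr; [nra|lra].
have /= hF := @ess_sup_ge _ _ _ (product_measure1 (@lebesgue_measure R) (@lebesgue_measure R))
  (fun p => (Normc.normc (complex_dilatation F (p.1 +i* p.2)))%:E).
apply: filterS hF => p hp.
by rewrite -lee_fin; apply: le_trans mk.
Qed.

Lemma uniformly_quasiregular_bound (F : R[i] -> R[i]) :
  uniformly_quasiregular F -> exists2 k : R, 0 <= k < 1 &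
  forall n, (1 <= n)%N -> {ae plane_measure R, forall p : R * R,
    Normc.normc (complex_dilatation (iter n F) (p.1 +i* p.2)) <= k}.
Proof.
move=> [_ /= hsup].
have [C C1 hC] : exists2 C : R, 1 <= C & forall n, (1 <= n)%N ->
    (maximal_dilatation (iter n F) <= C%:E)%E.
  set S := ereal_sup _ in hsup.
  have hS n : (1 <= n)%N -> (maximal_dilatation (iter n F) <= S)%E.
    by move=> n1; apply: ereal_sup_ubound; exists n.
  case: S hsup hS => [s _|//|_] hS.
    exists (Num.max 1 s); first by rewrite le_max lexx.
    by move=> n n1; apply: le_trans (hS n n1) _; rewrite lee_fin le_max lexx orbT.
  by exists 1 => // n n1; apply: le_trans (hS n n1) _; rewrite leNye.
exists ((C - 1) / (C + 1)).
  rewrite divr_ge0 /=; [|lra|lra].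
  by rewrite ltr_pdivrMr; lra.
by move=> n n1; apply: maximal_dilatation_le => //; exact: hC.
Qed.

Variables (al : R) (be : R[i]).
Hypothesis hbe : sqn be < al ^+ 2.

(* [ab] is the pair of Wirtinger derivatives. *)
Definition dilatation_le (k : R) (ab : R[i] * R[i]) : bool :=
  sqn ab.2 <= k ^+ 2 * sqn ab.1.

Lemma iter_fwd_orbit (c : R[i]) n :
  iter n (fun z => hmap al be z ^+ 2 + c) = fun z => fwd_orbit al be (fun=> c) z n.
Proof. by apply/funext => z; elim: n => //= n ->. Qed.

(** The derivatives are continuous, so a violation at one point spreads to an open set, which meets
    the full-measure set where the bound holds. *)
Lemma jac_bound (c : R[i]) (k : R) n z : 0 <= k ->
  {ae plane_measure R, forall p : R * R, Normc.normc (complex_dilatation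
    (iter n (fun z => hmap al be z ^+ 2 + c)) (p.1 +i* p.2)) <= k} ->
  dilatation_le k (jac al be (fun=> c) z n).
Proof.
move=> k0; rewrite iter_fwd_orbit => hae; rewrite /dilatation_le leNgt; apply/negP => hlt.
pose J (p : R * R) := jac al be (fun=> c) (p.1 +i* p.2) n.
pose phi p := sqn (J p).2 - k ^+ 2 * sqn (J p).1.
have cphi : continuous phi.
  have cp : ccont (fun p : R * R => p.1 +i* p.2).
    by split=> p; [exact: cvg_fst|exact: cvg_snd].
  have [c1 c2] := ccont_jac al be n (fun=> @ccont_cst R (R * R)%type c) cp.
  exact: sub_sqn_continuous.
have oU : open [set p | 0 < phi p].
  exact (@open_comp _ _ phi [set y | 0 < y] (fun t _ => cphi t) (@open_gt R 0)).
have Uz : [set p | 0 < phi p] (complex.Re z, complex.Im z).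
  by rewrite /= /phi /J /= subr_gt0; case: (z) hlt.
have [p hp] := ae_open_witness oU Uz hae.
have [ha hb] := wirtinger_orbit al be (fun=> c) n (p.1 +i* p.2).
rewrite /complex_dilatation ha hb.
rewrite /= /phi /J in hp; set a := (jac _ _ _ _ _).1 in hp *.
set b := (jac _ _ _ _ _).2 in hp *.
have hab : sqn b <= sqn a by apply: jac_det_ge0; exact: ltW.
(* The dilatation is thus a genuine quotient, not the default value of division by 0. *)
have a0 : 0 < sqn a.
  by have := mulr_ge0 (sqr_ge0 k) (sqn_ge0 a); lra.
rewrite Normc.normcM Normc.normcV !normc_sqn ler_pdivrMr ?sqrtr_gt0 // => h.
move: hp; rewrite subr_gt0 ltNge => /negP; apply.
rewrite -(sqr_sqrtr (sqn_ge0 a)) -(sqr_sqrtr (sqn_ge0 b)) -exprMn.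
by rewrite ler_sqr ?nnegrE ?mulr_ge0 ?sqrtr_ge0.
Qed.

(** Violation is an open condition on the scale [e]. If it held at e = 0, where the constants
    vanish, it would hold at some e' > 0, hence by [jac_scale] for the original iterate at z/e'. *)
Lemma jac_bound_homogeneous (c : R[i]) (k : R) n z :
  (forall w, dilatation_le k (jac al be (fun=> c) w n)) ->
  dilatation_le k (jac al be (fun=> 0) z n).
Proof.
move=> H; rewrite /dilatation_le leNgt; apply/negP => hlt.
pose gam (e : R) m := (e ^+ (2 ^ m.+1))%:C * c.
pose phi e := sqn (jac al be (gam e) z n).2 - k ^+ 2 * sqn (jac al be (gam e) z n).1.
have cphi : continuous phi.
  have cg m : ccont (gam ^~ m).
    apply: ccontM (ccont_cst _ _); split => e; first exact: exprn_continuous.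
    exact: cst_continuous.
  have [c1 c2] := ccont_jac al be n cg (@ccont_cst R R z).
  exact: sub_sqn_continuous.
have oU : open [set e | 0 < phi e].
  exact (@open_comp _ _ phi [set y | 0 < y] (fun t _ => cphi t) (@open_gt R 0)).
have U0 : [set e | 0 < phi e] 0.
  rewrite /= /phi subr_gt0 (_ : gam 0 = fun=> 0) //.
  by apply/funext => m; rewrite /gam expr0n expn_eq0 /= mul0r.
have /nbhs_ballP[e /= e0 eU] : nbhs (0 : R) [set e | 0 < phi e].
  exact: open_nbhs_nbhs.
have : 0 < phi (e / 2).
  apply: eU; rewrite /ball /= sub0r normrN gtr0_norm ?divr_gt0 //.
  by rewrite ltr_pdivrMr // ltr_pMr // ltr1n.
set e' := e / 2; have e'0 : 0 < e' by rewrite divr_gt0.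
have e'z : z = e'%:C * (e'%:C^-1 * z).
  by rewrite mulrA divff ?mul1r // -(rmorph0 (real_complex R)) (inj_eq (@complexI _)) gt_eqF.
rewrite /phi {1 2}e'z jac_scale /= !sqnM; apply/negP; rewrite -leNgt subr_le0.
by rewrite mulrCA ler_wpM2l ?sqn_ge0 //; exact: H.
Qed.

(* The odd function [w |-> h(w)^2 conj w] takes a nonzero real value on any path
   from [-1] to [1] that avoids [0]. *)
Lemma fixed_point : exists2 z, z != 0 & hmap al be z ^+ 2 = z.
Proof.
have h0 w : w != 0 -> hmap al be w != 0.
  apply: contraNneq => hw.
  have : sqn (al%:C * w) = sqn (be * conjc w).
    by rewrite -[RHS]sqnN; congr sqn; apply/eqP; rewrite -addr_eq0; apply/eqP.
  rewrite !sqnM sqnJ => /eqP; rewrite -subr_eq0 -mulrBl mulf_eq0 sqn_eq0.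
  by rewrite subr_eq0 /sqn /= expr0n addr0 gt_eqF.
(* A parabolic arc from -1 to 1 passing through i. *)
pose w (s : R) := s +i* (1 - s ^+ 2).
pose G z := hmap al be z ^+ 2 * conjc z.
have GN z : G (- z) = - G z.
  rewrite /G -mulN1r -(rmorphN1 (real_complex R)) hmap_scale conjcM conjc_real.
  by rewrite rmorphN1; ring.
have w0 s : w s != 0.
  rewrite eq_complex /=; apply/nandP; case: (eqVneq s 0) => [->|]; last by left.
  by right; rewrite expr0n subr0 oner_eq0.
have cw : ccont w.
  split; first by move=> s; exact: cvg_id.
  move=> s; rewrite (_ : (fun _ => _) = (fun=> 1) - (fun s : R => s ^+ 2)) //.
  apply: continuousB; first exact: cst_continuous.
  exact: exprn_continuous.
have [_ cG] : ccont (fun s => G (w s)).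
  by apply: ccontM (ccontJ cw); apply: ccontM; apply: ccont_hmap.
have [s _ hs] : exists2 s, s \in `[-1 : R, 1] & complex.Im (G (w s)) = 0.
  apply: (IVT (f := fun s => complex.Im (G (w s)))) => //.
    exact: continuous_subspaceT.
  have -> : w (-1) = - w 1 by rewrite /w sqrrN expr1n subrr; apply/eqP; rewrite eq_complex /= oppr0 !eqxx.
  rewrite GN raddfN /=; set g := complex.Im _.
  by rewrite ge_min le_max oppr_le0 oppr_ge0; have /orP[->|->] := le_total 0 g; rewrite ?orbT.
(* Oddness of [G] permits choosing the sign; [G z] > 0 says that h(z)^2 is a positive multiple of
   z. *)
have [z z0 [r r0 hz]] : exists2 z, z != 0 & exists2 r : R, 0 < r & G z = r%:C.
  have Gs0 : G (w s) != 0.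
    by rewrite mulf_neq0 // ?expf_neq0 ?h0 // conjc_eq0.
  have GR : G (w s) = (complex.Re (G (w s)))%:C.
    by move: hs; case: (G _) => x y /= ->.
  case: (ltrgt0P (complex.Re (G (w s)))) => hr.
  - by exists (w s) => //; exists (complex.Re (G (w s))).
  - exists (- w s); first by rewrite oppr_eq0.
    exists (- complex.Re (G (w s))); first by rewrite oppr_gt0.
    by rewrite GN [in LHS]GR rmorphN.
  - by move: Gs0; rewrite GR hr eqxx.
have sz : 0 < sqn z by rewrite lt_def sqn_eq0 z0 sqn_ge0.
(* Solves l^2 h(z)^2 = l z, which after multiplication by conj z reads l^2 r = l |z|^2. *)
pose l := sqn z / r; have l0 : 0 < l by rewrite divr_gt0.
exists (l%:C * z).
  by rewrite mulf_neq0 // -(rmorph0 (real_complex R)) (inj_eq (@complexI _)) gt_eqF.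
rewrite hmap_scale exprMn.
apply: (@mulIf _ (conjc z)); first by rewrite conjc_eq0.
have zz : z * conjc z = (sqn z)%:C.
  by case: (z) => x y; apply/eqP; rewrite eq_complex /sqn /=; apply/andP; split; apply/eqP; ring.
rewrite -[LHS]mulrA -/(G z) hz -[RHS]mulrA zz -rmorphXn -!rmorphM /=; congr (_%:C).
by rewrite /l; field; rewrite gt_eqF.
Qed.

(** The determinant of DH(z) is the product 2d of its eigenvalues; it is positive because |be| <
    |al| and h(z) <> 0. *)
Lemma fixed_det (z : R[i]) n : z != 0 -> hmap al be z ^+ 2 = z ->
  let d := 2 * complex.Re (2 * hmap al be z * al%:C) - 2 in
  0 < d /\ sqn (jac al be (fun=> 0) z n).1 - sqn (jac al be (fun=> 0) z n).2 = (2 * d) ^+ n.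
Proof.
move=> z0 hz d.
have hdet m : sqn (jac al be (fun=> 0) z m).1 - sqn (jac al be (fun=> 0) z m).2 =
    (4 * sqn (hmap al be z) * (al ^+ 2 - sqn be)) ^+ m.
  elim: m => [|m IH]; first by rewrite /sqn /=; ring.
  by rewrite /= orbit_fixed // jac_det_step IH [RHS]exprS.
have hd : 4 * sqn (hmap al be z) * (al ^+ 2 - sqn be) = 2 * d.
  have := fixed_sqn z0 hz; rewrite /d; set A := 2 * hmap al be z * al%:C.
  move=> hA; have hA' : sqn A = 4 * sqn (hmap al be z) * al ^+ 2.
    by rewrite /A !sqnM /sqn /=; ring.
  have hB : sqn (2 * hmap al be z * be) = 4 * sqn (hmap al be z) * sqn be.
    by rewrite !sqnM; congr (_ * _ * _); rewrite /sqn /=; ring.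
  by rewrite mulrBr -hA' -hB hA; ring.
split; last by rewrite hdet hd.
suff : 0 < 2 * d by rewrite pmulr_rgt0.
rewrite -hd !mulr_gt0 ?subr_gt0 // lt_def sqn_ge0 sqn_eq0 andbT.
by apply: contraNneq z0 => h; rewrite -hz h expr0n.
Qed.

Hypothesis be0 : be != 0.

Lemma not_uniformly_quasiregular (c : R[i]) :
  ~ uniformly_quasiregular (fun z => hmap al be z ^+ 2 + c).
Proof.
move=> /uniformly_quasiregular_bound[k /andP[k0 k1] hk].
have [z z0 hz] := fixed_point.
have bound n : dilatation_le k (jac al be (fun=> 0) z n).
  apply: (@jac_bound_homogeneous c) => w; case: n => [|n].
    by rewrite /dilatation_le /= /sqn /= !expr0n /= !addr0 mulr_ge0 ?sqr_ge0.
  by apply: jac_bound => //; exact: hk.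
pose B := 2 * hmap al be z * be.
have [d0 _] := fixed_det 0 z0 hz.
set d := 2 * _ - 2 in d0.
have k21 : k ^+ 2 < 1 by rewrite expr_lt1.
have B0 : 0 < sqn B.
  rewrite lt_def sqn_ge0 sqn_eq0 andbT !mulf_neq0 ?pnatr_eq0 //.
  by apply: contraNneq z0 => h; rewrite -hz h expr0n.
apply: (@powcoef_unbounded R d (sqn B * (1 - k ^+ 2))) => //.
  by rewrite mulr_gt0 // subr_gt0.
move=> n; have [_ <-] := fixed_det n z0 hz.
have hb : sqn (jac al be (fun=> 0) z n).2 = powcoef d n ^+ 2 * sqn B.
  by rewrite jac_fixed // sqnM /= /sqn /= expr0n addr0.
have := bound n; have := sqn_ge0 (jac al be (fun=> 0) z n).1.
have := sqn_ge0 (jac al be (fun=> 0) z n).2; rewrite /dilatation_le hb.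
move: (sqn _.1) => a; set b := _ * sqn B => b0 a0 hba.
rewrite mulrAC [_ * powcoef _ _ ^+ 2]mulrC -/b.
move: (k ^+ 2) k21 hba => q q1 hba.
(* The goal amounts to (2 - q) b <= a. From b <= q a one gets (2 - q) b <= q (2 - q) a, and 1 - q (2
   - q) = (1 - q)^2. *)
have : 0 <= (2 - q) * (q * a - b) by apply: mulr_ge0; lra.
by have := mulr_ge0 a0 (sqr_ge0 (1 - q)); lra.
Qed.

End Dilatation.

Theorem theorem2p6 (R : realType) (K theta : R) (hK : 0 < K) (hK1 : K != 1)
    (c : R[i]%C) :
  ~ uniformly_quasiregular (fun z : R[i]%C => affine_stretch K theta z ^+ 2 + c).
Proof.
set al := (K + 1) / 2.
set be : R[i] := (cos (2 * theta) +i* sin (2 * theta)) * ((K - 1) / 2)%:C.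
have hbe : sqn be = ((K - 1) / 2) ^+ 2.
  by rewrite sqnM /sqn /= cos2Dsin2 expr0n addr0 mul1r.
apply: (@not_uniformly_quasiregular R al be).
  (* The determinant of h is ((K + 1)/2)^2 - ((K - 1)/2)^2 = K > 0. *)
  by rewrite hbe /al -subr_gt0 (_ : _ - _ = K) //; field.
by rewrite -sqn_eq0 hbe sqrf_eq0 mulf_neq0 ?invr_eq0 ?pnatr_eq0 // subr_eq0.
Qed.
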